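(* Let $\rho(x)=c_d e^{-|x|^2/2}$ be the standard Gaussian density on $\mathbb{R}^d$. Then the inequality (valid for every compact $\mathcal{Y}\subset\mathbb{R}^d$ with some constant $C_{\rho,\mathcal{Y}}$) $$\|\phi_\mu-\phi_\nu\|_{L^2(\rho)}\leq C_{\rho,\mathcal{Y}}\,W_1(\mu,\nu)^{\frac12}\bigl(1+|\log W_1(\mu,\nu)|\bigr)^{\frac12}\qquad\text{for all probability measures }\mu,\nu\text{ supported in }\mathcal{Y}$$ is sharp up to the logarithmic factor, in the following sense: there exist a compact set $\mathcal{Y}\subset\mathbb{R}^d$, constants $c>0$ and $a\geq 0$, and sequences of probability measures $(\mu_k)$, $(\nu_k)$ supported in $\mathcal{Y}$ with $0<W_1(\mu_k,\nu_k)\to 0$ as $k\to\infty$ and $$\|\phi_{\mu_k}-\phi_{\nu_k}\|_{L^2(\rho)}\geq c\,W_1(\mu_k,\nu_k)^{\frac12}\,\bigl|\log W_1(\mu_k,\nu_k)\bigr|^{-a}\qquad\text{for all sufficiently large }k.$$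
   Context: $c_d$ is the normalizing constant. $W_1(\mu,\nu)=\inf_{\gamma}\int \|x-y\|\,d\gamma(x,y)$, the infimum being over couplings $\gamma$ of $\mu$ and $\nu$. For a fixed absolutely continuous probability measure $\rho$ on $\mathbb{R}^d$ with finite second moment and a probability measure $\mu$ with finite second moment: the Brenier map $T_\mu$ is the ($\rho$-a.e. unique) optimal transport map from $\rho$ to $\mu$ for the quadratic cost $\|x-y\|^2$; by Brenier's theorem it is the gradient of a convex function. The Brenier potential $\phi_\mu$ is the lower semi-continuous convex function $\phi_\mu\in L^2(\rho)$ such that $T_\mu=\nabla\phi_\mu$ ($\rho$-a.e.) and $\int\phi_\mu\,d\rho=0$ (unique as an element of $L^2(\rho)$ in this setting). *)

(* Defs.v *)
From HB Require Import structures.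
From mathcomp Require Import all_boot all_order all_algebra.
From mathcomp Require Import all_classical all_reals all_analysis.
From mathcomp Require Import measurable_realfun.
Set Implicit Arguments.
Unset Strict Implicit.
Unset Printing Implicit Defensive.
Import Order.TTheory GRing.Theory Num.Theory.
Import numFieldNormedType.Exports.
Local Open Scope classical_set_scope.
Local Open Scope ring_scope.

(* R^d is 'rV[R]_d, with the (product) topology of the library and the Borel
   sigma-algebra of that topology. The library norm on 'rV[R]_d is the sup
   norm; everything metric below uses [enorm] instead. *)

Section borel_rV.
Context (R : realType) (d : nat).

Let borel_rV : set (set 'rV[R]_d) := <<s open >>.

Let borel_rV0 : borel_rV set0.
Proof. exact: sigma_algebra0. Qed.

Let borel_rVC A : borel_rV A -> borel_rV (~` A).
Proof. exact: sigma_algebraC. Qed.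

Let borel_rV_bigcup (F : _^nat) :
  (forall i, borel_rV (F i)) -> borel_rV (\bigcup_i (F i)).
Proof. exact: sigma_algebra_bigcup. Qed.

HB.instance Definition _ := @isMeasurable.Build default_measure_display
  'rV[R]_d borel_rV borel_rV0 borel_rVC borel_rV_bigcup.

End borel_rV.

Section euclidean.
Context (R : realType) (d : nat).
Implicit Types x y : 'rV[R]_d.

Definition dotp x y : R := \sum_i x 0 i * y 0 i.

Definition enorm x : R := Num.sqrt (dotp x x).

End euclidean.

Lemma open_measurable_rV (R : realType) d (A : set 'rV[R]_d) :
  open A -> measurable A.
Proof. exact: sub_sigma_algebra. Qed.

Lemma measurable_coord (R : realType) d (i : 'I_d) :
  measurable_fun [set: 'rV[R]_d] (fun x => x 0 i : R).
Proof.
apply: (measurability _ (RGenOpens.measurableE R)) => _ [_ [a [b ->] <-]].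
rewrite setTI; apply: open_measurable_rV; apply: open_comp.
  by move=> x _; exact: coord_continuous.
exact: interval_open.
Qed.

Lemma measurable_fun_rV d1 (T : measurableType d1) (R : realType) d
    (f : T -> 'rV[R]_d) :
  (forall i, measurable_fun [set: T] (fun t => f t 0 i : R)) ->
  measurable_fun [set: T] f.
Proof.
move=> mf; have RE : @measurable _ 'rV[R]_d = <<s open >> by [].
apply: (measurability _ RE) => _ [U oU <-].
rewrite setTI.
pose box (p : 'rV[rat]_d * nat) : set 'rV[R]_d :=
  [set y | forall i, `|y 0 i - ratr (p.1 0 i)| < p.2.+1%:R^-1].
have mbox p : measurable (f @^-1` box p).
  rewrite (_ : _ @^-1` _ = \bigcap_k (if insub k is Some i
      then [set t | `|f t 0 i - ratr (p.1 0 i)| < p.2.+1%:R^-1]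
      else setT)); last first.
    apply/seteqP; split => t /= bt.
      by move=> k _; case: insubP => //= i _ _; exact: bt.
    by move=> i; have := bt i I; rewrite valK.
  apply: bigcapT_measurable => k; case: insubP => //= i _ _.
  rewrite (_ : [set t | _] =
      (fun t => f t 0 i : R) @^-1` ball (ratr (p.1 0 i) : R) p.2.+1%:R^-1).
    rewrite -[X in measurable X]setTI; apply: mf => //.
    by apply: open_measurable; exact: ball_open.
  by apply/seteqP; split => t /=; rewrite -ball_normE/= distrC.
pose F k := if unpickle k is Some p then
  if `[< box p `<=` U >] then f @^-1` box p else set0 else set0.
rewrite (_ : _ @^-1` _ = \bigcup_k F k); last first.
  apply/seteqP; split => t /=; last first.
    move=> [k _]; rewrite /F; case: (unpickle k) => // p.
    by case: asboolP => // pU; exact: pU.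
  move=> Uft; have /nbhs_ballP[e /= e0 eU] := open_nbhs_nbhs (conj oU Uft).
  have e2 : 0 < e / 2 by rewrite divr_gt0.
  have [n _ /(_ n (leqnn n)) /= ne] := near_infty_natSinv_lt (PosNum e2).
  have [c cP] : exists c : 'rV[rat]_d,
      forall i, `|f t 0 i - ratr (c 0 i)| < n.+1%:R^-1.
    have /choice[c cP] (i : 'I_d) : exists q : rat,
        `|f t 0 i - ratr q| < n.+1%:R^-1.
      have [|q] := @rat_in_itvoo R (f t 0 i - n.+1%:R^-1) (f t 0 i + n.+1%:R^-1).
        by rewrite ltrBlDr -addrA ltrDl addr_gt0// invr_gt0.
      by rewrite in_itv/= => qf; exists q; rewrite distrC ltr_distl.
    by exists (\row_i c i) => i; rewrite mxE.
  exists (pickle (c, n)) => //; rewrite /F pickleK asboolT//= => y yc.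
  apply: eU; split => // i j; rewrite (ord1 i) -ball_normE/=.
  rewrite [ltRHS](splitr e) (le_lt_trans (ler_distD (ratr (c 0 j)) _ _))//.
  by rewrite ltrD// ?(lt_trans _ ne)// 1?distrC.
by apply: bigcupT_measurable => k; rewrite /F; case: (unpickle k) => // p;
  case: ifP.
Qed.

Section lebesgue_rV.
Context (R : realType).

Definition consrV d (p : measurableTypeR R * 'rV[R]_d) : 'rV[R]_d.+1 :=
  \row_j oapp (p.2 0) p.1 (unlift ord0 j).

Definition unconsrV d (x : 'rV[R]_d.+1) : measurableTypeR R * 'rV[R]_d :=
  (x 0 ord0, \row_j x 0 (lift ord0 j)).

Lemma consrVK d : cancel (@consrV d) (@unconsrV d).
Proof.
move=> [a x]; rewrite /unconsrV/= mxE unlift_none/=; congr (_, _).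
by apply/rowP => j; rewrite !mxE liftK.
Qed.

Lemma unconsrVK d : cancel (@unconsrV d) (@consrV d).
Proof.
by move=> x; apply/rowP => j; rewrite mxE; case: unliftP => [i|] ->//=; rewrite mxE.
Qed.

Lemma measurable_consrV d : measurable_fun setT (@consrV d).
Proof.
apply: measurable_fun_rV => j.
case: (unliftP ord0 j) => [i|] ->.
  rewrite (_ : (fun _ => _) = (fun x : 'rV[R]_d => x 0 i) \o snd).
    by apply: measurableT_comp => //; exact: measurable_coord.
  by apply/funext => p; rewrite /= mxE liftK.
rewrite (_ : (fun _ => _) = fst)//.
by apply/funext => p; rewrite /= mxE unlift_none.
Qed.

Lemma measurable_unconsrV d : measurable_fun [set: 'rV[R]_d.+1] (@unconsrV d).
Proof.
apply/measurable_fun_pairP; split; first exact: measurable_coord.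
apply: measurable_fun_rV => i.
rewrite (_ : (fun _ => _) = (fun x : 'rV[R]_d.+1 => x 0 (lift ord0 i))).
  exact: measurable_coord.
by apply/funext => x; rewrite /= mxE.
Qed.

Section step.
Context (d : nat) (m : {sigma_finite_measure set 'rV[R]_d -> \bar R}).

Definition lebesgue_cons : set 'rV[R]_d.+1 -> \bar R :=
  pushforward (@lebesgue_measure R \x m)%E (@consrV d).

Let lebesgue_cons0 : lebesgue_cons set0 = 0%E.
Proof. by rewrite /lebesgue_cons /pushforward preimage_set0 measure0. Qed.

Let lebesgue_cons_ge0 A : (0 <= lebesgue_cons A)%E.
Proof. by rewrite /lebesgue_cons /pushforward; exact: measure_ge0. Qed.

Let lebesgue_cons_sigma_additive : semi_sigma_additive lebesgue_cons.
Proof.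
move=> F mF tF mUF; rewrite /lebesgue_cons /pushforward preimage_bigcup.
apply: measure_semi_sigma_additive.
- by move=> n; rewrite -[X in measurable X]setTI; exact: measurable_consrV.
- apply/trivIsetP => /= i j _ _ ij; rewrite -preimage_setI.
  by move/trivIsetP : tF => /(_ _ _ _ _ ij) ->//; rewrite preimage_set0.
- by rewrite -preimage_bigcup -[X in measurable X]setTI; exact: measurable_consrV.
Qed.

HB.instance Definition _ := isMeasure.Build _ _ _ lebesgue_cons
  lebesgue_cons0 lebesgue_cons_ge0 lebesgue_cons_sigma_additive.

Let lebesgue_cons_sigma_finite : sigma_finite setT lebesgue_cons.
Proof.
have /sigma_finiteP[F [TF ndF Foo]] := sigma_finiteT (@lebesgue_measure R).
have /sigma_finiteP[G [TG ndG Goo]] := sigma_finiteT m.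
exists (fun n => (@unconsrV d) @^-1` (F n `*` G n)).
  rewrite -preimage_bigcup (_ : \bigcup_n _ = setT) ?preimage_setT//.
  rewrite -setXTT TF TG predeqE => -[x y]; split.
    by move=> [n _ []/= ? ?]; split; exists n.
  move=> [/= [n _ Fnx] [k _ Gky]]; exists (maxn n k) => //; split.
  - by move: x Fnx; exact/subsetPset/ndF/leq_maxl.
  - by move: y Gky; exact/subsetPset/ndG/leq_maxr.
move=> k; have [mF Fk] := Foo k; have [mG Gk] := Goo k; split.
  by rewrite -[X in measurable X]setTI; apply: measurable_unconsrV => //;
    exact: measurableX.
rewrite /lebesgue_cons /pushforward (_ : _ @^-1` _ = F k `*` G k); last first.
  by rewrite -comp_preimage (_ : _ \o _ = id)//; apply/funext/consrVK.
by rewrite product_measure1E// lte_mul_pinfty// ge0_fin_numE.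
Qed.

HB.instance Definition _ := Measure_isSigmaFinite.Build _ _ _ lebesgue_cons
  lebesgue_cons_sigma_finite.

End step.

(* Lebesgue measure on R^d, as the d-fold product of [lebesgue_measure]. *)
Fixpoint lebesgue_rV d : {sigma_finite_measure set 'rV[R]_d -> \bar R} :=
  if d is d'.+1 then lebesgue_cons (lebesgue_rV d') else \d_(0 : 'rV[R]_0).

Lemma ge0_integral_lebesgue_rVS d (f : 'rV[R]_d.+1 -> \bar R) :
  measurable_fun setT f -> (forall x, 0 <= f x)%E ->
  (\int[lebesgue_rV d.+1]_x f x =
   \int[lebesgue_measure]_a \int[lebesgue_rV d]_x f (consrV (a, x)))%E.
Proof.
move=> mf f0.
transitivity (\int[(@lebesgue_measure R \x lebesgue_rV d)]_p f (consrV p))%E.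
  have := @ge0_integral_pushforward _ _ _ _ _ _ (@measurable_consrV d)
    (@lebesgue_measure R \x lebesgue_rV d)%E setT f measurableT mf.
  move=> /(_ (fun x _ => f0 x)).
  exact.
rewrite fubini_tonelli1//.
by apply: measurableT_comp => //; exact: measurable_consrV.
Qed.

End lebesgue_rV.

Lemma measurable_dotp (R : realType) d :
  measurable_fun [set: 'rV[R]_d] (fun x => dotp x x).
Proof.
apply: measurable_sum => i.
by apply: measurable_funM; exact: measurable_coord.
Qed.

Lemma measurable_enorm (R : realType) d :
  measurable_fun [set: 'rV[R]_d] (@enorm R d).
Proof.
apply: measurableT_comp; last exact: measurable_dotp.
exact: continuous_measurable_fun (@sqrt_continuous R).
Qed.

Lemma enormX2 (R : realType) d (x : 'rV[R]_d) : enorm x ^+ 2 = dotp x x.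
Proof. by rewrite sqr_sqrtr// sumr_ge0// => i _; rewrite -expr2 sqr_ge0. Qed.

Definition gaussian_pdf (R : realType) d (x : 'rV[R]_d) : R :=
  (Num.sqrt (2 * pi))^-1 ^+ d * expR (- enorm x ^+ 2 / 2).

Lemma gaussian_pdf_ge0 (R : realType) d (x : 'rV[R]_d) : 0 <= gaussian_pdf x.
Proof. by rewrite mulr_ge0 ?expR_ge0// exprn_ge0// invr_ge0 sqrtr_ge0. Qed.

Lemma measurable_gaussian_pdf (R : realType) d :
  measurable_fun setT (@gaussian_pdf R d).
Proof.
apply: measurable_funM => //; apply: measurableT_comp => //.
apply: measurable_funM => //; apply: measurableT_comp => //.
by apply: measurable_funX; exact: measurable_enorm.
Qed.

Lemma gaussian_pdf_cons (R : realType) d (a : R) (x : 'rV[R]_d) :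
  gaussian_pdf (consrV (a, x)) = normal_pdf 0 1 a * gaussian_pdf x.
Proof.
rewrite normal_pdfE ?oner_neq0// /normal_peak /normal_fun /gaussian_pdf.
rewrite exprS mulrACA -expRD !enormX2 /dotp big_ord_recl mxE unlift_none/=.
rewrite expr1n subr0 mul1r -[pi *+ 2]mulr_natl.
congr (_ * _ * expR _); rewrite opprD mulrDl -expr2; congr (_ + - _ / _).
by apply: eq_bigr => i _; rewrite mxE liftK.
Qed.

Lemma integral_gaussian_pdf (R : realType) d :
  (\int[lebesgue_rV R d]_x (gaussian_pdf x)%:E = 1)%E.
Proof.
elim: d => [|d IHd].
  have mg : measurable_fun setT (EFin \o @gaussian_pdf R 0).
    by apply/measurable_EFinP; exact: measurable_gaussian_pdf.
  transitivity (\d_(0%R : 'rV[R]_0) [set: 'rV[R]_0] * (gaussian_pdf (0%R : 'rV[R]_0))%:E)%E.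
    exact: integral_dirac.
  rewrite diracT mul1e /gaussian_pdf enormX2 /dotp big_ord0.
  by rewrite expr0 mul1r oppr0 mul0r expR0.
rewrite ge0_integral_lebesgue_rVS; last 2 first.
- by apply/measurable_EFinP; exact: measurable_gaussian_pdf.
- by move=> x; rewrite lee_fin gaussian_pdf_ge0.
rewrite -[RHS](@integral_normal_pdf R 0 1); apply: eq_integral => a _.
under eq_integral do rewrite gaussian_pdf_cons EFinM.
rewrite ge0_integralZl//.
- by rewrite IHd mule1.
- by apply/measurable_EFinP; exact: measurable_gaussian_pdf.
- by move=> x _; rewrite lee_fin gaussian_pdf_ge0.
- by rewrite lee_fin normal_pdf_ge0.
Qed.

Section std_gaussian.
Context (R : realType) (d : nat).

Definition std_gaussian (A : set 'rV[R]_d) : \bar R :=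
  (\int[lebesgue_rV R d]_(x in A) (gaussian_pdf x)%:E)%E.

Let std_gaussian0 : std_gaussian set0 = 0%E.
Proof. by rewrite /std_gaussian integral_set0. Qed.

Let std_gaussian_ge0 A : (0 <= std_gaussian A)%E.
Proof. by apply: integral_ge0 => x _; rewrite lee_fin gaussian_pdf_ge0. Qed.

Let std_gaussian_sigma_additive : semi_sigma_additive std_gaussian.
Proof.
move=> F mF tF mUF; rewrite /std_gaussian ge0_integral_bigcup//.
- apply: is_cvg_ereal_nneg_natsum_cond => n _ _.
  by apply: integral_ge0 => x _; rewrite lee_fin gaussian_pdf_ge0.
- apply: measurable_funTS; apply/measurable_EFinP.
  exact: measurable_gaussian_pdf.
- by move=> x _; rewrite lee_fin gaussian_pdf_ge0.
Qed.

HB.instance Definition _ := isMeasure.Build _ _ _ std_gaussian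
  std_gaussian0 std_gaussian_ge0 std_gaussian_sigma_additive.

Let std_gaussianT : std_gaussian setT = 1%E.
Proof. exact: integral_gaussian_pdf. Qed.

HB.instance Definition _ := Measure_isProbability.Build _ _ _ std_gaussian
  std_gaussianT.

End std_gaussian.

Section transport.
Context (R : realType) (d : nat).
Local Notation Rd := 'rV[R]_d.
Local Open Scope ereal_scope.
Implicit Types (rho mu nu : probability Rd R) (T : Rd -> Rd) (phi : Rd -> \bar R).

Definition coupling mu nu (g : probability (Rd * Rd)%type R) :=
  forall A, measurable A ->
    g (A `*` setT) = mu A /\ g (setT `*` A) = nu A.

Definition W1 mu nu : \bar R :=
  ereal_inf [set \int[g]_p (enorm (p.1 - p.2))%:E | g in coupling mu nu].

Definition transport_map rho mu T :=
  measurable_fun setT T /\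
  forall A, measurable A -> pushforward rho T A = mu A.

(* A minimiser of the Monge problem from rho to mu for the quadratic cost. *)
Definition brenier_map rho mu T :=
  transport_map rho mu T /\
  forall S, transport_map rho mu S ->
    \int[rho]_x (enorm (x - T x) ^+ 2)%:E <=
    \int[rho]_x (enorm (x - S x) ^+ 2)%:E.

(* phi is finite near x and differentiable at x, with gradient g. *)
Definition has_gradient phi (x g : Rd) :=
  (\forall y \near x, phi y \is a fin_num) /\
  is_diff x (fine \o phi : Rd -> R) (dotp g).

(* Convexity of a function with values in ]-oo, +oo]; [convex_function] of the
   library is restricted to real-valued functions. *)
Definition convex_efun phi :=
  (forall x, phi x != -oo) /\
  forall x y (t : R), (0 < t < 1)%R ->
    phi (t *: x + (1 - t) *: y)%R <= t%:E * phi x + (1 - t)%:E * phi y.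

(* The Brenier potential is only unique up to rho-negligible sets, hence a
   predicate rather than a function of mu. Lower semicontinuity makes phi Borel,
   so that the third clause does express phi \in L^2(rho). *)
Definition brenier_potential rho mu phi :=
  [/\ lower_semicontinuous phi, convex_efun phi,
      'N[rho]_2%:E[phi] < +oo,
      \int[rho]_x phi x = 0 &
      exists2 T, brenier_map rho mu T &
        {ae rho, forall x, has_gradient phi x (T x)}].

End transport.

(* Main.v *)
(* Let mu_t be the law of the map sending the half-space {x_0 > t} to the unit
   vector e and its complement to 0, and nu the Dirac mass at 0.  Then
   W1(mu_t, nu) is the Gaussian tail P(x_0 > t) <= exp(-t^2/2), while the Brenier
   potentials are (x_0 - t)_+ and 0 up to additive constants.  Their L^2 distance,
   whatever these constants are, is at least of order exp(-t^2/4) up to a power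
   of t, and t^2 <= 2 |log W1|.

   A convex function whose gradient is a.e. 0 or e is a.e. of the form
   max(m, x_0 + b), and the mass of {gradient = e} determines m - b; so the
   uniqueness of the potentials does not require that of the optimal map. *)
From HB Require Import structures.
Require Import Defs.
From mathcomp Require Import all_boot all_order all_algebra.
From mathcomp Require Import all_classical all_reals all_analysis.
From mathcomp Require Import measurable_realfun ring lra.
Set Implicit Arguments.
Unset Strict Implicit.
Unset Printing Implicit Defensive.
Import Order.TTheory GRing.Theory Num.Theory.
Import numFieldNormedType.Exports.
Local Open Scope classical_set_scope.
Local Open Scope ring_scope.
Local Open Scope ereal_scope.

(** * One-dimensional Gaussian estimates *)

Section normal_estimates.
Context {R : realType}.
Local Notation leb := (@lebesgue_measure R).

Lemma normal_pdf1E (m x : R) : normal_pdf m 1 x =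
  (normal_peak 1 * expR (- (x - m) ^+ 2 / 2))%R.
Proof. by rewrite normal_pdfE ?oner_neq0// /normal_fun expr1n. Qed.

(** The Radon-Nikodym derivative of [normal_prob] and [normal_pdf] have the same integral over every
    measurable set, hence agree almost everywhere. *)
Lemma ge0_integral_normal_prob (m s : R) (f : R -> \bar R) :
  measurable_fun setT f -> (forall x, 0 <= f x) ->
  \int[normal_prob m s]_x f x = \int[leb]_x (f x * (normal_pdf m s x)%:E).
Proof.
move=> mf f0; have dom := normal_prob_dominates m s.
rewrite -(Radon_Nikodym_SigmaFinite.change_of_variables dom)//.
have intf := Radon_Nikodym_SigmaFinite.f_integrable dom.
have mpdf : measurable_fun setT (EFin \o normal_pdf m s).
  by apply/measurable_EFinP; exact: measurable_normal_pdf.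
apply: ge0_ae_eq_integral => //.
- by apply: emeasurable_funM => //; exact: measurable_int intf.
- exact: emeasurable_funM.
- by move=> x _; rewrite mule_ge0// Radon_Nikodym_SigmaFinite.f_ge0.
- by move=> x _; rewrite mule_ge0// lee_fin normal_pdf_ge0.
apply: ae_eqe_mul2l; apply: integral_ae_eq => //.
by move=> E _ mE; rewrite -Radon_Nikodym_SigmaFinite.f_integral.
Qed.

(** Half of the exponent absorbs the square: x^2 exp(-x^2/2) <= 4 exp(-x^2/4), and the right-hand
    side is a multiple of the density of variance 2, whence [s] and [C]. *)
Lemma normal_prob_sqr_lty : \int[normal_prob 0 1]_x ((x ^+ 2)%:E : \bar R) < +oo.
Proof.
have msq : measurable_fun [set: R] (fun x : R => (x ^+ 2)%:E : \bar R).
  by apply/measurable_EFinP; exact: measurable_funX.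
rewrite ge0_integral_normal_prob//; last by move=> x; rewrite lee_fin sqr_ge0.
pose s : R := Num.sqrt 2; have s2 : (s ^+ 2 = 2)%R by rewrite sqr_sqrtr.
have s0 : (s != 0)%R by rewrite sqrtr_eq0 -ltNge.
pose C : R := (4 * normal_peak 1 / normal_peak s)%R.
have C0 : (0 <= C)%R by rewrite divr_ge0 ?mulr_ge0// normal_peak_ge0.
have mpdf r : measurable_fun setT (EFin \o @normal_pdf R 0 r).
  by apply/measurable_EFinP; exact: measurable_normal_pdf.
apply: (@le_lt_trans _ _ (\int[leb]_x (C%:E * (normal_pdf 0 s x)%:E))).
  apply: ge0_le_integral => //.
  - by move=> x _; rewrite lee_fin mulr_ge0 ?sqr_ge0 ?normal_pdf_ge0.
  - by apply: emeasurable_funM => //; exact: mpdf.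
  - by apply: emeasurable_funM => //; exact: mpdf.
  - move=> x _; rewrite -!EFinM lee_fin normal_pdf1E normal_pdfE// /normal_fun s2.
    have -> e : (C * (normal_peak s * e) = normal_peak 1 * (4 * e))%R.
      by rewrite /C [LHS]mulrA divfK ?gt_eqF ?normal_peak_gt0// -mulrA mulrCA.
    rewrite mulrCA ler_wpM2l ?normal_peak_ge0// !subr0 -[(2 *+ 2)%R]mulr_natr.
    set u := (x ^+ 2 / 4)%R; have u0 : (0 <= u)%R by rewrite divr_ge0 ?sqr_ge0.
    have -> : (- x ^+ 2 / 2 = - u - u)%R by rewrite /u; field.
    have -> : (- x ^+ 2 / (2 * 2) = - u)%R by rewrite /u; field.
    have -> : (x ^+ 2 = 4 * u)%R by rewrite /u; field.
    rewrite expRD mulrA ler_wpM2r ?expR_ge0// -mulrA ler_piMr//.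
    by rewrite expRN ler_pdivrMr ?expR_gt0// mul1r (le_trans _ (expR_ge1Dx _))// lerDr.
rewrite ge0_integralZl//; first by rewrite integral_normal_pdf mule1 ltry.
- exact: mpdf.
- by move=> x _; rewrite lee_fin normal_pdf_ge0.
Qed.

(** For x > t >= 0 one has x^2 >= t^2 + (x - t)^2, so the density is at most exp(-t^2/2) times the
    density centred at t, whose total mass is 1. *)
Lemma normal_prob_tail (t : R) : (0 <= t)%R ->
  normal_prob 0 1 `]t, +oo[%classic <= (expR (- t ^+ 2 / 2))%:E.
Proof.
move=> t0; rewrite /normal_prob.
have mpdf r : measurable_fun setT (EFin \o @normal_pdf R r 1).
  by apply/measurable_EFinP; exact: measurable_normal_pdf.
apply: (@le_trans _ _ (\int[leb]_(x in `]t, +oo[)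
    ((expR (- t ^+ 2 / 2))%:E * (normal_pdf t 1 x)%:E))).
  apply: ge0_le_integral => //.
  - by move=> x _; rewrite lee_fin normal_pdf_ge0.
  - by apply: measurable_funTS; exact: mpdf.
  - by apply: measurable_funTS; apply: emeasurable_funM => //; exact: mpdf.
  - move=> x /=; rewrite in_itv/= andbT => tx.
    rewrite -EFinM lee_fin !normal_pdf1E mulrCA ler_wpM2l ?normal_peak_ge0//.
    rewrite -expRD ler_expR subr0.
    have : (0 <= t * (x - t))%R by rewrite mulr_ge0// subr_ge0 ltW.
    by lra.
rewrite ge0_integralZl//.
- rewrite -[leRHS]mule1 lee_wpmul2l ?lee_fin ?expR_ge0//.
  by rewrite -[leRHS](@integral_normal_pdf R t 1) ge0_subset_integral//;
    [exact: mpdf|move=> x _; rewrite lee_fin normal_pdf_ge0].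
- by apply: measurable_funTS; exact: mpdf.
- by move=> x _; rewrite lee_fin normal_pdf_ge0.
Qed.

(** The density decreases on the nonnegative half-line, so its minimum over the interval is attained
    at [b]. *)
Lemma normal_prob_itv_ge (a b : R) : (0 <= a)%R -> (a <= b)%R ->
  ((b - a) * normal_pdf 0 1 b)%:E <= normal_prob 0 1 `[a, b]%classic.
Proof.
move=> a0 ab; rewrite /normal_prob.
have -> : ((b - a) * normal_pdf 0 1 b)%:E =
    \int[leb]_(x in `[a, b]) (cst (normal_pdf 0 1 b)%:E x).
  rewrite integral_cst//= lebesgue_measure_itv/= lte_fin.
  have [_|ba] := ltP a b; first by rewrite -EFinD -EFinM mulrC.
  by rewrite mule0 (le_anti (introT andP (conj ab ba))) subrr mul0r.
apply: ge0_le_integral => //.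
- by move=> x _; rewrite lee_fin normal_pdf_ge0.
- apply: measurable_funTS; apply/measurable_EFinP.
  exact: measurable_normal_pdf.
- move=> x /=; rewrite in_itv/= => /andP[ax xb].
  rewrite lee_fin !normal_pdf1E ler_wpM2l ?normal_peak_ge0// ler_expR !subr0.
  by rewrite ler_wpM2r// lerN2 ler_pXn2r// nnegrE (le_trans a0)// (le_trans ax).
Qed.

End normal_estimates.

(** * The first coordinate under the Gaussian measure *)

Section gaussian_coord.
Context {R : realType} {n : nat}.
Local Notation rho := (@std_gaussian R n.+1).

(** The density factorises along [consrV], and the remaining [n] coordinates integrate to 1. *)
Lemma std_gaussian_coord (B : set R) : measurable B ->
  rho [set x : 'rV[R]_n.+1 | B (x 0%R ord0)] = normal_prob 0 1 B.
Proof.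
move=> mB; set A := [set x | _].
have mA : measurable A.
  rewrite -[A]setTI; exact: measurable_coord.
have mpdf k : measurable_fun setT (EFin \o @gaussian_pdf R k).
  by apply/measurable_EFinP; exact: measurable_gaussian_pdf.
rewrite /= /std_gaussian integral_mkcond ge0_integral_lebesgue_rVS; last 2 first.
- by apply/(measurable_restrictT _ mA)/measurable_funTS; exact: mpdf.
- by move=> x; rewrite patchE; case: ifP => // _; rewrite lee_fin gaussian_pdf_ge0.
rewrite /normal_prob [RHS]integral_mkcond; apply: eq_integral => a _.
transitivity (\int[lebesgue_rV R n]_x
    (((EFin \o normal_pdf 0 1) \_ B) a * (gaussian_pdf x)%:E)).
  apply: eq_integral => x _; rewrite !patchE.
  have -> : (consrV (a, x) \in A) = (a \in B).
    by apply/idP/idP; rewrite !inE /A/= mxE unlift_none.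
  by case: ifP => _; rewrite ?mul0e// gaussian_pdf_cons EFinM.
rewrite ge0_integralZl//.
- by rewrite integral_gaussian_pdf mule1.
- exact: mpdf.
- by move=> x _; rewrite lee_fin gaussian_pdf_ge0.
- by rewrite patchE; case: ifP => // _; rewrite lee_fin normal_pdf_ge0.
Qed.

Lemma std_gaussian_coord_sqr_lty :
  \int[rho]_x ((x 0%R ord0 ^+ 2)%:E : \bar R) < +oo.
Proof.
rewrite (le_lt_trans _ (@normal_prob_sqr_lty R))//.
have msq : measurable_fun [set: R] (fun x : R => (x ^+ 2)%:E : \bar R).
  by apply/measurable_EFinP; exact: measurable_funX.
have mc := @measurable_coord R n.+1 ord0.
have := @ge0_integral_pushforward _ _ _ (measurableTypeR R) R
  (fun x : 'rV[R]_n.+1 => x 0%R ord0) mc rho setT _ measurableT msq.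
rewrite preimage_setT => <-; last by move=> x _; rewrite lee_fin sqr_ge0.
rewrite (@eq_measure_integral _ (measurableTypeR R) R _ (normal_prob 0 1))//.
by move=> B mB _; exact: std_gaussian_coord.
Qed.

End gaussian_coord.

(** * Borel sets of row vectors and the supporting hyperplane inequality *)

Section row_vectors.
Context {R : realType} {d : nat}.
Implicit Types (x y g : 'rV[R]_d) (phi : 'rV[R]_d -> \bar R).

Lemma measurable_set1_rV x : measurable [set x].
Proof.
rewrite -[X in measurable X]setCK; apply: measurableC.
apply: open_measurable_rV; apply: closed_openC.
exact/accessible_closed_set1/hausdorff_accessible/norm_hausdorff.
Qed.

Lemma lower_semicontinuous_measurable_rV phi :
  lower_semicontinuous phi -> measurable_fun setT phi.
Proof.
move=> /lower_semicontinuousP sc.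
apply: (measurability _ (ErealGenOInfty.measurableE R)).
move=> /= _ [_ [a ->]] <-; rewrite setTI preimage_itvoy.
by apply: open_measurable_rV; exact: sc.
Qed.

Lemma dotp0l y : dotp 0 y = 0%R :> R.
Proof. by rewrite /dotp big1// => i _; rewrite mxE mul0r. Qed.

Lemma dotp_delta (i : 'I_d) y : dotp (delta_mx 0%R i) y = y 0%R i.
Proof.
rewrite /dotp (bigD1 i)//= mxE !eqxx mul1r big1 ?addr0// => j ji.
by rewrite mxE (negbTE ji) andbF mul0r.
Qed.

(** By convexity the difference quotient of [phi] at [x] along [y - x] is at most [phi y - phi x]
    for steps in ]0, 1[; its limit from the right is the directional derivative. *)
Lemma convex_gradient_le phi x g : convex_efun phi -> has_gradient phi x g ->
  forall y, phi x + (dotp g (y - x))%:E <= phi y.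
Proof.
move=> [phiNoo cphi] [finphi dphi] y.
have fx : phi x \is a fin_num by exact: nbhs_singleton finphi.
case Ey : (phi y) => [r| |]; last 2 first.
- by rewrite leey.
- by have := phiNoo y; rewrite Ey.
set f : 'rV[R]_d -> R := fine \o phi in dphi *.
have Ex : phi x = (f x)%:E by rewrite /f/= fineK.
rewrite Ex -EFinD lee_fin -lerBrDl.
have df : differentiable f x by exact: ex_diff.
have <- : ('D_(y - x) f x = dotp g (y - x))%R.
  by rewrite deriveE// diff_val.
have /cvg_ex[l fl] : derivable f x (y - x) by exact: diff_derivable.
have /cvg_dnbhs_at_right fl' := fl.
rewrite /derive (cvg_lim _ fl)//.
apply: (cvgr_to_le fl'); near=> h.
have h0 : (0 < h)%R by near: h; exact: nbhs_right_gt.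
have h1 : (h < 1)%R by near: h; exact: nbhs_right_lt.
have := cphi y x h; rewrite h0 h1 => /(_ isT).
have -> : (h *: y + (1 - h) *: x = h *: (y - x) + x)%R.
  by rewrite scalerBr scalerBl scale1r -addrA [(- _ + _)%R]addrC addrA.
rewrite Ey Ex -!EFinM -EFinD /= /GRing.scale/= => phih.
rewrite mulrC ler_pdivrMr// lerBlDr.
(* Convexity bounds this value above by a real and [phiNoo] excludes -oo, so [fine] does not return
   its default value here. *)
move: phih; rewrite /f/=; have := phiNoo (h *: (y - x) + x)%R.
case: (phi _) => [s| |]//= _; rewrite lee_fin => /le_trans; apply.
by rewrite -/(f x); lra.
Unshelve. all: by end_near. Qed.

End row_vectors.

(** * Strict monotonicity of the Gaussian tail *)

Section normal_tail.
Context {R : realType}.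

(** An interval [c, e] of positive mass fits strictly between the two thresholds; taking c above
    max(a, 0) keeps it where [normal_prob_itv_ge] applies. One tail is closed and the other open
    because the potential will first be located only up to the hyperplane bounding its flat part. *)
Lemma normal_tail_lt (a b : R) : (a < b)%R -> (0 < b)%R ->
  normal_prob 0 1 `[b, +oo[%classic < normal_prob 0 1 `]a, +oo[%classic.
Proof.
move=> ab b0; set c : R := ((Num.max a 0 + b) / 2)%R.
have ac : (a < c)%R by rewrite /c; case: (leP a 0%R) => ?; lra.
have c0 : (0 <= c)%R by rewrite /c; case: (leP a 0%R) => ?; lra.
have cb : (c < b)%R by rewrite /c; case: (leP a 0%R) => ?; lra.
set e : R := ((c + b) / 2)%R.
have ce : (c < e)%R by rewrite /e; lra.
have eb : (e < b)%R by rewrite /e; lra.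
apply: (@lt_le_trans _ _ (normal_prob 0 1 (`[c, e]%classic `|` `[b, +oo[%classic))).
  rewrite measureU//; last first.
    apply/seteqP; split => // x [] /=; rewrite !in_itv/= andbT => /andP[_ xe] bx.
    by have := le_lt_trans xe eb; rewrite ltNge bx.
  rewrite lteDr ?fin_num_measure//.
  apply: lt_le_trans (normal_prob_itv_ge c0 (ltW ce)).
  by rewrite lte_fin normal_pdf1E !mulr_gt0 ?subr_gt0 ?expR_gt0 ?normal_peak_gt0 ?oner_neq0.
apply: le_measure; rewrite ?inE//; first exact: measurableU.
move=> x [] /=; rewrite !in_itv/= !andbT; first by move=> /andP[cx _]; exact: lt_le_trans cx.
by move=> bx; rewrite (lt_le_trans ab).
Qed.

End normal_tail.

(** * The half-space maps, their laws, and the shape of every potential *)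

Section halfspace.
Context {R : realType} {n : nat}.
Local Notation Rd := 'rV[R]_n.+1.
Local Notation rho := (@std_gaussian R n.+1).

Definition unit_vec : Rd := delta_mx 0%R ord0.

Definition halfspace (t : R) : set Rd := [set x | (t < x 0%R ord0)%R].

Definition halfspace_map (t : R) (x : Rd) : Rd :=
  if (t < x 0%R ord0)%R then unit_vec else 0%R.

Lemma unit_vec_neq0 : unit_vec != 0%R.
Proof.
by apply/eqP => /rowP/(_ ord0)/eqP; rewrite !mxE !eqxx oner_eq0.
Qed.

Lemma measurable_halfspace t : measurable (halfspace t).
Proof.
rewrite -[X in measurable X]setTI.
have -> : halfspace t = (fun x : Rd => x 0%R ord0) @^-1` `]t, +oo[%classic.
  by apply/seteqP; split => x; rewrite /halfspace/= in_itv/= andbT.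
exact: measurable_coord.
Qed.

Lemma measurable_halfspace_map t : measurable_fun setT (halfspace_map t).
Proof.
apply: measurable_fun_ifT => //.
by apply: measurable_fun_ltr => //; exact: measurable_coord.
Qed.

HB.instance Definition _ t := isMeasurableFun.Build _ _ _ _ (halfspace_map t)
  (measurable_halfspace_map t).

Definition halfspace_law t : probability Rd R :=
  distribution rho (halfspace_map t).

Lemma halfspace_lawE t A : halfspace_law t A = rho (halfspace_map t @^-1` A).
Proof. by []. Qed.

Lemma halfspace_map_preimage1 t : halfspace_map t @^-1` [set unit_vec] = halfspace t.
Proof.
apply/seteqP; split => x; rewrite /halfspace /halfspace_map/=; case: ifP => //.
by move=> _ e0; have := unit_vec_neq0; rewrite -e0 eqxx.
Qed.

Lemma halfspace_map_preimage0 t : halfspace_map t @^-1` [set 0%R] = ~` halfspace t.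
Proof.
apply/seteqP; split => x; rewrite /halfspace /halfspace_map/=; case: ifP => //.
by move=> _ e0; have := unit_vec_neq0; rewrite e0 eqxx.
Qed.

Lemma halfspace_map_preimage01 t :
  halfspace_map t @^-1` [set 0%R; unit_vec] = setT.
Proof.
by apply/seteqP; split => x //=; rewrite /halfspace_map; case: ifP; [right|left].
Qed.

Lemma measure_halfspace t :
  rho (halfspace t) = normal_prob 0 1 `]t, +oo[%classic.
Proof.
rewrite -(@std_gaussian_coord R n)//; congr (rho _).
by apply/seteqP; split => x; rewrite /halfspace/= in_itv/= andbT.
Qed.

Lemma halfspace_gt0 t : (0 <= t)%R -> 0 < rho (halfspace t).
Proof.
move=> t0; rewrite measure_halfspace.
apply: le_lt_trans (@normal_tail_lt _ t (t + 1)%R _ _) => //; first by rewrite ltrDl.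
by rewrite ltr_wpDl.
Qed.

Lemma halfspace_setC_gt0 t : (0 < t)%R -> 0 < rho (~` halfspace t).
Proof.
move=> t0; apply: (@lt_le_trans _ _ (rho [set x : Rd | x 0%R ord0 \in `[0%R, t]])).
  rewrite (std_gaussian_coord (measurable_itv `[0%R, t])).
  apply: lt_le_trans (normal_prob_itv_ge (lexx 0%R) (ltW t0)).
  by rewrite lte_fin subr0 normal_pdf1E !mulr_gt0 ?expR_gt0 ?normal_peak_gt0 ?oner_neq0.
apply: le_measure; rewrite ?inE.
- rewrite -[X in measurable X]setTI.
  exact: (@measurable_coord R _ ord0 measurableT _ (measurable_itv `[0%R, t])).
- by apply: measurableC; exact: measurable_halfspace.
- by move=> x; rewrite /halfspace/= in_itv/= => /andP[_]; rewrite leNgt => /negP.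
Qed.

(** The target law gives no mass to the complement of its two atoms. This serves both for the map
    attached to an arbitrary potential and for the competitors in the Monge problem. *)
Lemma transport_halfspace_ae t T :
  transport_map rho (halfspace_law t) T ->
  {ae rho, forall x, T x = 0%R \/ T x = unit_vec}.
Proof.
move=> [mT lawT]; have m01 : measurable [set (0%R : Rd); unit_vec].
  by apply: measurableU; exact: measurable_set1_rV.
exists (T @^-1` ~` [set 0%R; unit_vec]); split.
- by rewrite -[X in measurable X]setTI; apply: mT => //; exact: measurableC.
- rewrite [LHS](lawT _ (measurableC m01)) halfspace_lawE -preimage_setC.
  by rewrite halfspace_map_preimage01 setCT measure0.
- by move=> x.
Qed.

(** Otherwise [A] would lie in the exceptional null set. It yields points of differentiability with
    a prescribed gradient. *)
Lemma ae_positive_ex (P : Rd -> Prop) (A : set Rd) :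
  measurable A -> 0 < rho A -> {ae rho, forall x, P x} -> exists2 x, A x & P x.
Proof.
move=> mA A0 aeP; apply: contrapT => nAP.
suff /(measure_negligible mA) AE : rho.-negligible A by rewrite AE ltxx in A0.
by apply: negligibleS aeP => x Ax Px; apply: nAP; exists x.
Qed.

Lemma le_ae_subset (A B : set Rd) : measurable A -> measurable B ->
  {ae rho, forall x, A x -> B x} -> rho A <= rho B.
Proof.
move=> mA mB AB; rewrite -[leRHS]adde0 -(@measure_negligible _ _ _ rho (A `\` B)).
- rewrite -measureU//; first last.
  - by apply/seteqP; split => // x [] ? [].
  - exact: measurableD.
  apply: le_measure; rewrite ?inE//.
    by apply: measurableU => //; exact: measurableD.
  by move=> x Ax; have [Bx|nBx] := pselect (B x); [left|right].
- exact: measurableD.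
- by apply: negligibleS AB => x [Ax nBx] /(_ Ax).
Qed.

(** The gradient vanishes almost everywhere, and a convex function is minimal wherever its gradient
    vanishes; all these points share the minimum value. *)
Lemma potential_dirac0 psi : brenier_potential rho \d_(0%R : Rd) psi ->
  exists b : R, {ae rho, forall x, psi x = b%:E}.
Proof.
move=> [_ cpsi _ _ [T [[mT lawT] _] gradT]].
have T0 : {ae rho, forall x, T x = 0%R}.
  have m0 := measurable_set1_rV (0%R : Rd).
  exists (T @^-1` ~` [set 0%R]); split => //.
  - by rewrite -[X in measurable X]setTI; apply: mT => //; exact: measurableC.
  - by rewrite [LHS](lawT _ (measurableC m0)) /= diracE memNset//; apply.
have grad0 : {ae rho, forall x, has_gradient psi x 0%R}.
  by apply: filterS2 gradT T0 => x /= /[swap] ->.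
have min0 x : has_gradient psi x 0%R -> forall y, psi x <= psi y.
  by move=> gx y; have := convex_gradient_le cpsi gx y; rewrite dotp0l adde0.
have [x0 _ gx0] : exists2 x, setT x & has_gradient psi x 0%R.
  by apply: ae_positive_ex => //; rewrite probability_setT.
exists (fine (psi x0)); apply: filterS grad0 => x gx.
rewrite fineK; last by case: gx0 => /nbhs_singleton.
by apply/eqP; rewrite eq_le !min0.
Qed.

Lemma potential_halfspace t phi : (0 < t)%R ->
  brenier_potential rho (halfspace_law t) phi ->
  exists m : R,
    {ae rho, forall x, phi x = (m + Num.max 0 (x 0%R ord0 - t))%R%:E}.
Proof.
move=> t0 [_ cphi _ _ [T [trT _] gradT]].
have T01 := transport_halfspace_ae trT; have [mT lawT] := trT.
have mT1 : measurable (T @^-1` [set unit_vec]).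
  by rewrite -[X in measurable X]setTI; apply: mT => //; exact: measurable_set1_rV.
have mT0 : measurable (T @^-1` [set 0%R]).
  by rewrite -[X in measurable X]setTI; apply: mT => //; exact: measurable_set1_rV.
have rT1 : rho (T @^-1` [set unit_vec]) = rho (halfspace t).
  rewrite [LHS](lawT _ (measurable_set1_rV _)) halfspace_lawE.
  by rewrite halfspace_map_preimage1.
have rT0 : rho (T @^-1` [set 0%R]) = rho (~` halfspace t).
  rewrite [LHS](lawT _ (measurable_set1_rV _)) halfspace_lawE.
  by rewrite halfspace_map_preimage0.
have le0 x : has_gradient phi x 0%R -> forall y, phi x <= phi y.
  by move=> gx y; have := convex_gradient_le cphi gx y; rewrite dotp0l adde0.
have le1 x : has_gradient phi x unit_vec ->
    forall y : Rd, phi x + (y 0%R ord0 - x 0%R ord0)%:E <= phi y.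
  move=> gx y; have := convex_gradient_le cphi gx y.
  by rewrite dotp_delta !mxE.
have [x0 /= Tx0 gx0] : exists2 x, (T @^-1` [set 0%R]) x & has_gradient phi x (T x).
  by apply: ae_positive_ex => //; rewrite rT0 halfspace_setC_gt0.
have [x1 /= Tx1 gx1] :
    exists2 x, (T @^-1` [set unit_vec]) x & has_gradient phi x (T x).
  by apply: ae_positive_ex => //; rewrite rT1 halfspace_gt0// ltW.
rewrite {}Tx0 in gx0; rewrite {}Tx1 in gx1.
(* [m] is the minimum of [phi], attained at [x0]; [b] is the intercept of the affine minorant of
   slope [unit_vec] that touches [phi] at [x1]. *)
pose m := fine (phi x0); pose b := (fine (phi x1) - x1 0%R ord0)%R.
have Em : phi x0 = m%:E by rewrite fineK//; case: gx0 => /nbhs_singleton.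
have Eb : phi x1 = (b + x1 0%R ord0)%:E.
  by rewrite subrK fineK//; case: gx1 => /nbhs_singleton.
have gem y : m%:E <= phi y by rewrite -Em; exact: le0.
have geb (y : Rd) : (b + y 0%R ord0)%:E <= phi y.
  apply: le_trans (le1 _ gx1 y); rewrite Eb -EFinD lee_fin; lra.
have grad0 x : has_gradient phi x 0%R -> phi x = m%:E.
  by move=> gx; apply/eqP; rewrite eq_le gem -Em le0.
(* Parallel supporting hyperplanes coincide: the one at [x], evaluated at [x1], gives the missing
   upper bound. *)
have grad1 x : has_gradient phi x unit_vec -> phi x = (b + x 0%R ord0)%:E.
  move=> gx; apply/eqP; rewrite eq_le geb andbT.
  have := le1 _ gx x1; rewrite Eb -leeBrDr// -EFinB => /le_trans; apply.
  by rewrite lee_fin; lra.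
(* The two minorants m and b + x_0 cross where x_0 = s, so gradient 0 forces x_0 <= s and gradient
   [unit_vec] forces x_0 >= s. *)
pose s := (m - b)%R.
have ae0 : {ae rho, forall x, T x = 0%R -> (x 0%R ord0 <= s)%R}.
  apply: filterS gradT => x /= /[swap] -> /grad0 Ex.
  by have := geb x; rewrite Ex lee_fin /s; lra.
have ae1 : {ae rho, forall x, T x = unit_vec -> (s <= x 0%R ord0)%R}.
  apply: filterS gradT => x /= /[swap] -> /grad1 Ex.
  by have := gem x; rewrite Ex lee_fin /s; lra.
(* Up to null sets, the event that [T] equals [unit_vec] lies between the open and the closed
   half-space at [s], while its mass is that of the half-space at [t]. Strict decrease of the tail
   rules out both strict inequalities. *)
have st : s = t.
  apply/eqP; rewrite eq_le !leNgt; apply/andP; split; apply/negP => lt_st.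
    have := normal_tail_lt lt_st (lt_trans t0 lt_st).
    rewrite -measure_halfspace -(@std_gaussian_coord R n)// ltNge => /negP; apply.
    rewrite -rT1; apply: le_ae_subset => //.
      by rewrite -[X in measurable X]setTI; exact: measurable_coord.
    by apply: filterS ae1 => x + Tx => /(_ Tx); rewrite /= in_itv/= andbT.
  have := normal_tail_lt lt_st t0.
  rewrite -measure_halfspace ltNge => /negP; apply.
  apply: (@le_trans _ _ (rho (halfspace t))).
    rewrite -rT1; apply: le_ae_subset => //; first exact: measurable_halfspace.
    apply: filterS2 T01 ae0 => x + + sx => -[Tx /(_ Tx)|//].
    by rewrite leNgt sx.
  rewrite measure_halfspace; apply: le_measure; rewrite ?inE//.
  by move=> x /=; rewrite !in_itv/= !andbT => /ltW.
exists m; apply: filterS2 T01 gradT => x /= [Tx|Tx]; rewrite {}Tx => gx.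
  have Ex := grad0 _ gx; rewrite Ex; have := geb x; rewrite Ex lee_fin => bx.
  by rewrite max_l ?addr0// -st /s; lra.
have Ex := grad1 _ gx; rewrite Ex; have := gem x; rewrite Ex lee_fin => bx.
by rewrite max_r -st /s; [congr EFin|]; lra.
Qed.

End halfspace.

(** * Lower bound on the distance between potentials, uniform in the additive constants *)

Section potential_gap.
Context {R : realType} {n : nat}.
Local Notation Rd := 'rV[R]_n.+1.
Local Notation rho := (@std_gaussian R n.+1).

(** The slab has width 1/t, and since t >= 1 and i + 1 <= 4 the square of its right end is at most
    t^2 + 8 + 16; half of 24 gives the constant 12. *)
Lemma normal_prob_slab_ge (t i : R) : (1 <= t)%R -> (0 <= i <= 3)%R ->
  (normal_peak 1 * expR (- 12) * expR (- t ^+ 2 / 2) / t)%:E <=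
  normal_prob 0 1 `[(t + i / t)%R, (t + (i + 1) / t)%R]%classic.
Proof.
move=> t1 /andP[i0 i3]; have t0 : (0 < t)%R by rewrite (lt_le_trans _ t1).
have a0 : (0 <= t + i / t)%R by rewrite addr_ge0 ?divr_ge0// ltW.
have ab : (t + i / t <= t + (i + 1) / t)%R.
  by rewrite lerD2l ler_wpM2r ?invr_ge0 ?(ltW t0)//; lra.
apply: le_trans (normal_prob_itv_ge a0 ab).
rewrite lee_fin normal_pdf1E subr0.
have -> : ((t + (i + 1) / t) - (t + i / t) = t^-1)%R by field; rewrite gt_eqF.
rewrite mulrC ler_wpM2l ?invr_ge0 ?(ltW t0)// -mulrA ler_wpM2l ?normal_peak_ge0//.
rewrite -expRD ler_expR.
have : (t^-1 <= 1)%R by rewrite invf_le1.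
have : (0 <= t^-1)%R by rewrite invr_ge0 ltW.
have : (t * t^-1 = 1)%R by rewrite divff// gt_eqF.
move: (t^-1)%R => u tu u0 u1.
have -> : ((t + (i + 1) * u) ^+ 2 = t ^+ 2 + 2 * (i + 1) * (t * u) + ((i + 1) * u) ^+ 2)%R.
  by ring.
rewrite tu mulr1.
have iu0 : (0 <= (i + 1) * u)%R by rewrite mulr_ge0//; lra.
have iu4 : ((i + 1) * u <= 4)%R by rewrite -[leRHS]mulr1 ler_pM//; lra.
have : (((i + 1) * u) ^+ 2 <= 4 ^+ 2)%R by rewrite ler_pXn2r ?nnegrE.
by lra.
Qed.

(** The constant of [normal_prob_slab_ge], divided by the 4 that comes from squaring the pointwise
    bound 1/(2t). *)
Definition gap_cst : R := (normal_peak 1 * expR (- 12) / 4)%R.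

Lemma gap_cst_gt0 : (0 < gap_cst)%R.
Proof. by rewrite divr_gt0// mulr_gt0 ?expR_gt0 ?normal_peak_gt0 ?oner_neq0. Qed.

Lemma potential_gap (t m b : R) (phi psi : Rd -> \bar R) : (1 <= t)%R ->
  measurable_fun setT phi -> measurable_fun setT psi ->
  {ae rho, forall x, phi x = (m + Num.max 0 (x 0%R ord0 - t))%R%:E} ->
  {ae rho, forall x, psi x = b%:E} ->
  (gap_cst * expR (- t ^+ 2 / 2) / t ^+ 3)%:E <=
  \int[rho]_x (`|phi x - psi x| `^ 2).
Proof.
move=> t1 mphi mpsi aephi aepsi; have t0 : (0 < t)%R by rewrite (lt_le_trans _ t1).
pose q := (m - b)%R.
(* On two slabs at distance [1/t] the function [q + (u - t)] cannot be small on
   both, whatever the constant [q]. *)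
have [i i03 qi] : exists2 i : R, (0 <= i <= 3)%R &
    forall u, (t + i / t <= u <= t + (i + 1) / t)%R -> ((2 * t)^-1 <= `|q + (u - t)|)%R.
  (* The slabs are t + [1/t, 2/t] and t + [3/t, 4/t]. The threshold 5/2 is the middle of the gap
     between them, so one of the two stays at distance 1/(2t) from the zero of q + (u - t). *)
  have [qle|qgt] := leP q (- (5 / 2) / t)%R.
    exists 1%R; first by lra.
    move=> u /andP[_]; rewrite invfM ler_normr => uu; apply/orP; right.
    by move: uu qle; move: (t^-1)%R => v; lra.
  exists 3%R; first by lra.
  move=> u /andP[uu _]; rewrite invfM ler_normr; apply/orP; left.
  by move: uu qgt; move: (t^-1)%R => v; lra.
pose B : set Rd := [set x : Rd | x 0%R ord0 \in `[(t + i / t)%R, (t + (i + 1) / t)%R]].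
have mitv := measurable_itv `[(t + i / t)%R, (t + (i + 1) / t)%R].
have mB : measurable B.
  rewrite -[X in measurable X]setTI.
  exact: (@measurable_coord R _ ord0 measurableT _ mitv).
have m1B : measurable_fun setT (fun x : Rd => (\1_B x)%:E : \bar R).
  by apply/measurable_EFinP; exact: measurable_indic.
have mabs : measurable_fun setT (fun x => `|phi x - psi x| `^ 2).
  apply: (@measurableT_comp _ _ _ _ _ _ (fun y : \bar R => y `^ 2)).
    exact: measurable_poweR.
  by apply: measurableT_comp => //; exact: emeasurable_funB.
(* A Chebyshev bound: the integrand is at least (2t)^-2 on the slab [B], where the maximum equals
   x_0 - t because [B] lies beyond the hyperplane x_0 = t. *)
apply: (@le_trans _ _ (\int[rho]_x (((2 * t)^-1 ^+ 2)%:E * (\1_B x)%:E))).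
  rewrite ge0_integralZl//; last by rewrite lee_fin sqr_ge0.
  rewrite integral_indic// setIT /=.
  have -> : rho B = normal_prob 0 1 _ := std_gaussian_coord mitv.
  have := @normal_prob_slab_ge t i t1 i03.
  have c0 : (0 <= (2 * t)^-1 ^+ 2)%R by rewrite sqr_ge0.
  move=> /(lee_wpmul2l (x := (((2 * t)^-1 ^+ 2)%:E))); rewrite lee_fin => /(_ c0).
  apply: le_trans; rewrite -EFinM lee_fin /gap_cst le_eqVlt; apply/orP; left.
  by apply/eqP; field; rewrite gt_eqF.
apply: ae_ge0_le_integral => //.
- by move=> x _; rewrite -EFinM lee_fin mulr_ge0 ?sqr_ge0.
- exact: emeasurable_funM.
- by move=> x _; exact: poweR_ge0.
- apply: filterS2 aephi aepsi => x /= -> -> _.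
  have -> : ((m + Num.max 0 (x 0%R ord0 - t))%:E - b%:E)%E =
      (q + Num.max 0 (x 0%R ord0 - t))%R%:E by rewrite -EFinB; congr EFin; rewrite /q; ring.
  rewrite abse_EFin poweR_EFin -EFinM lee_fin (powR_mulrn 2)//.
  have [Bx|nBx] := boolP (x \in B); last by rewrite indicE (negbTE nBx) mulr0 sqr_ge0.
  rewrite indicE Bx mulr1 ler_pXn2r ?nnegrE ?invr_ge0 ?mulr_ge0 ?(ltW t0)//.
  move: Bx; rewrite inE /B/= in_itv/= => Bx.
  rewrite max_r ?qi// subr_ge0; case/andP: Bx => + _; apply: le_trans.
  by rewrite lerDl divr_ge0 ?(ltW t0)//; case/andP: i03.
Qed.

End potential_gap.

(** * The Wasserstein distance to the Dirac mass *)

Section W1_halfspace.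
Context {R : realType} {n : nat}.
Local Notation Rd := 'rV[R]_n.+1.
Local Notation rho := (@std_gaussian R n.+1).

Lemma enorm_unit_vec : enorm (@unit_vec R n) = 1%R.
Proof. by rewrite /enorm dotp_delta !mxE !eqxx sqrtr1. Qed.

Lemma enorm0 : enorm (0%R : Rd) = 0%R.
Proof. by rewrite /enorm dotp0l sqrtr0. Qed.

Lemma measurable_enorm_sub :
  measurable_fun [set: (Rd * Rd)%type] (fun p => (enorm (p.1 - p.2)%R)%:E : \bar R).
Proof.
apply/measurable_EFinP; apply: measurableT_comp; first exact: measurable_enorm.
apply: measurable_fun_rV => i.
apply: (eq_measurable_fun (fun p : (Rd * Rd)%type => p.1 0%R i - p.2 0%R i)%R).
  by move=> p _; rewrite !mxE.
by apply: measurable_funB; apply: measurableT_comp (@measurable_coord R _ i) _.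
Qed.

(** The marginals force p.2 = 0 and p.1 to be 0 or [unit_vec] almost everywhere, so the cost is the
    indicator of p.1 = [unit_vec], the same for every coupling. *)
Lemma coupling_cost t g : coupling (halfspace_law t) \d_(0%R : Rd) g ->
  \int[g]_p (enorm (p.1 - p.2)%R)%:E = rho (halfspace t).
Proof.
move=> cg; have m0 := measurable_set1_rV (0%R : Rd).
have me := measurable_set1_rV (@unit_vec R n).
have m01 : measurable [set (0%R : Rd); unit_vec] by exact: measurableU.
have me1 : measurable ([set @unit_vec R n] `*` [set: Rd]) by exact: measurableX.
have ae2 : {ae g, forall p, p.2 = 0%R}.
  exists (setT `*` ~` [set 0%R]); split.
  - by apply: measurableX => //; exact: measurableC.
  - have [_ ->] := cg _ (measurableC m0).
    by rewrite /= diracE memNset//; apply.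
  - by move=> p /= p2; split.
have ae1 : {ae g, forall p, p.1 = 0%R \/ p.1 = unit_vec}.
  exists ((~` [set 0%R; unit_vec]) `*` setT); split.
  - by apply: measurableX => //; exact: measurableC.
  - have [-> _] := cg _ (measurableC m01).
    by rewrite halfspace_lawE -preimage_setC halfspace_map_preimage01 setCT measure0.
  - by move=> p /= p2; split.
transitivity (\int[g]_p (\1_([set @unit_vec R n] `*` setT) p)%:E).
  apply: ge0_ae_eq_integral => //.
  - exact: measurable_enorm_sub.
  - by apply/measurable_EFinP; exact: measurable_indic.
  - by move=> p _; rewrite lee_fin sqrtr_ge0.
  apply: filterS2 ae1 ae2 => -[x y]/= + -> _; rewrite subr0 => -[|] ->.
    rewrite enorm0 indicE memNset// => -[/= e0 _].
    by have := @unit_vec_neq0 R n; rewrite -e0 eqxx.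
  by rewrite enorm_unit_vec indicE mem_set.
rewrite integral_indic// setIT /=.
have [-> _] := cg _ me.
by rewrite halfspace_lawE halfspace_map_preimage1.
Qed.

Definition halfspace_plan t (x : Rd) : (Rd * Rd)%type := (halfspace_map t x, 0%R).

Lemma measurable_halfspace_plan t : measurable_fun setT (halfspace_plan t).
Proof.
apply/measurable_fun_pairP; split; last exact: measurable_cst.
exact: measurable_halfspace_map.
Qed.

HB.instance Definition _ t := isMeasurableFun.Build _ _ _ _ (halfspace_plan t)
  (measurable_halfspace_plan t).

(** Some coupling must exist, since the infimum over an empty set would be +oo. *)
Lemma coupling_halfspace_plan t :
  coupling (halfspace_law t) \d_(0%R : Rd) (distribution rho (halfspace_plan t)).
Proof.
move=> A mA; split.
  rewrite halfspace_lawE.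
  transitivity (rho (halfspace_plan t @^-1` (A `*` setT))) => //; congr (rho _).
  by apply/seteqP; split => x /=; [case|split].
transitivity (rho (halfspace_plan t @^-1` (setT `*` A))) => //; rewrite /= diracE.
have [A0|A0] := boolP (0%R \in A).
  rewrite (_ : _ @^-1` _ = setT) ?probability_setT//.
  by apply/seteqP; split => x //= _; split => //; exact: set_mem.
rewrite (_ : _ @^-1` _ = set0) ?measure0//.
by apply/seteqP; split => x //= -[_] /= /mem_set; exact/negP.
Qed.

Lemma W1_halfspace t : W1 (halfspace_law t) \d_(0%R : Rd) = rho (halfspace t).
Proof.
rewrite /W1 (_ : image _ _ = [set rho (halfspace t)]) ?ereal_inf1//.
apply/seteqP; split => y /=.
  by move=> [g cg <-]; exact: coupling_cost.
move=> ->; exists (distribution rho (halfspace_plan t)).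
  exact: coupling_halfspace_plan.
exact/coupling_cost/coupling_halfspace_plan.
Qed.

End W1_halfspace.

(** * Gradients of locally affine functions *)

Section gradient.
Context {R : realType} {d : nat}.
Implicit Types (x y g : 'rV[R]_d).

Lemma dotp_is_linear g : linear (dotp g : 'rV[R]_d -> R).
Proof.
move=> a x y; rewrite /dotp /GRing.scale/= mulr_sumr -big_split/=.
by apply: eq_bigr => i _; rewrite !mxE mulrDr mulrCA.
Qed.

HB.instance Definition _ g :=
  GRing.isLinear.Build R 'rV[R]_d R _ (dotp g) (dotp_is_linear g).

Lemma continuous_dotp g : continuous (dotp g : 'rV[R]_d -> R).
Proof.
apply: (@continuous_big R^o 'I_d +%R 0%R xpredT).
  exact: (@add_continuous R^o).
move=> i _ y.
apply: (@continuousM _ _ (cst (g 0%R i)) (fun z : 'rV[R]_d => z 0%R i : R)).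
  exact: cst_continuous.
exact: coord_continuous.
Qed.

(** The first-order remainder is identically 0 near [x], hence negligible, and uniqueness of the
    differential identifies it with [dotp g]. *)
Lemma near_affine_has_gradient (f : 'rV[R]_d -> R) x g :
  (\forall y \near x, f y = f x + dotp g (y - x))%R ->
  has_gradient (fun y => (f y)%:E) x g.
Proof.
move=> fx; split; first by near=> y.
have E : (f \o shift x = cst (f x) + (dotp g : 'rV[R]_d -> R) +o_ (0%R : 'rV[R]_d) id)%R.
  have key : \forall h \near (0%R : 'rV[R]_d), f (h + x)%R = (f x + dotp g h)%R.
    have := fx; rewrite (near_shift 0%R x)/=; apply: filterS => h.
    by rewrite /= subr0 addrK.
  apply/eqaddoP => e e0; near=> h.
  have Eh : f (h + x)%R = (f x + dotp g h)%R by near: h.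
  rewrite (_ : (_ - _)%R h = 0%R); first by rewrite normr0 mulr_ge0// ltW.
  by rewrite -[LHS]/(f (h + x) - (f x + dotp g h))%R Eh subrr.
have dE := diff_unique (@continuous_dotp g) E.
apply: DiffDef => //.
apply/diff_locallyP; rewrite dE; split => //; exact: continuous_dotp.
Unshelve. all: by end_near. Qed.

End gradient.

(** * Optimality of the half-space map and existence of the potentials *)

Section halfspace_potential.
Context {R : realType} {n : nat}.
Local Notation Rd := 'rV[R]_n.+1.
Local Notation rho := (@std_gaussian R n.+1).

Lemma enorm_sub_unit_vec (x : Rd) :
  (enorm (x - unit_vec) ^+ 2 = enorm x ^+ 2 - 2 * x 0 ord0 + 1)%R.
Proof.
rewrite !enormX2 /dotp !(bigD1 ord0 (P := xpredT))//= !mxE !eqxx.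
under eq_bigr => i /negbTE i0 do rewrite !mxE i0 andbF subr0.
by rewrite /=; ring.
Qed.

Lemma measurable_transport_cost (T : Rd -> Rd) : measurable_fun setT T ->
  measurable_fun setT (fun x : Rd => (enorm (x - T x) ^+ 2)%R%:E : \bar R).
Proof.
move=> mT; apply/measurable_EFinP; apply: measurable_funX.
apply: measurableT_comp; first exact: measurable_enorm.
apply: measurable_fun_rV => i.
apply: (eq_measurable_fun (fun x : Rd => x 0%R i - T x 0%R i)%R).
  by move=> x _; rewrite !mxE.
apply: measurable_funB; first exact: measurable_coord.
exact: (measurableT_comp (@measurable_coord R _ i) mT).
Qed.

(* Adding the price [2 t - 1] to the target point [unit_vec] makes the target
   chosen by [halfspace_map t] the cheapest one for every source point; the
   total price paid depends only on the target law. *)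
Lemma brenier_map_halfspace t : (1 <= t)%R ->
  brenier_map rho (halfspace_law t) (halfspace_map t).
Proof.
move=> t1; have trT : transport_map rho (halfspace_law t) (halfspace_map t).
  by split => [|A mA]; [exact: measurable_halfspace_map|].
(* With t >= 1 the price is nonnegative, so that every integral below is of a nonnegative
   function. *)
split=> // S trS; have c0 : 0 <= (2 * t - 1)%:E by rewrite lee_fin; lra.
have mcost T : transport_map rho (halfspace_law t) T ->
    measurable_fun setT (fun x : Rd => (enorm (x - T x) ^+ 2)%R%:E : \bar R).
  by case=> mT _; exact: measurable_transport_cost.
have mpre T : transport_map rho (halfspace_law t) T ->
    measurable (T @^-1` [set unit_vec]).
  case=> mT _; rewrite -[X in measurable X]setTI.
  by apply: mT => //; exact: measurable_set1_rV.
have mind T : transport_map rho (halfspace_law t) T ->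
    measurable_fun setT (fun x : Rd => (\1_(T @^-1` [set unit_vec]) x)%:E : \bar R).
  by move=> trM; apply/measurable_EFinP; apply: measurable_indic; exact: mpre.
have total T : transport_map rho (halfspace_law t) T ->
    \int[rho]_x ((enorm (x - T x) ^+ 2)%R%:E +
                 (2 * t - 1)%:E * (\1_(T @^-1` [set unit_vec]) x)%:E) =
    \int[rho]_x (enorm (x - T x) ^+ 2)%R%:E +
      (2 * t - 1)%:E * rho (halfspace t).
  move=> trM; rewrite ge0_integralD//.
  - rewrite ge0_integralZl//; last exact: mind.
    rewrite integral_indic//; last exact: mpre.
    rewrite setIT; congr (_ + _ * _); have [_ lawT] := trM.
    rewrite [LHS](lawT _ (measurable_set1_rV _)) halfspace_lawE.
    by rewrite halfspace_map_preimage1.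
  - by move=> x _; rewrite lee_fin sqr_ge0.
  - exact: mcost.
  - by move=> x _; rewrite mule_ge0// lee_fin.
  - by apply: emeasurable_funM => //; exact: mind.
(* The total price is finite, so it can be added to both sides and cancelled in the extended
   reals. *)
have fin_price : (2 * t - 1)%:E * rho (halfspace t) \is a fin_num.
  by rewrite fin_numM// fin_num_measure//; exact: measurable_halfspace.
rewrite -(leeD2rE _ _ fin_price) -!total//.
apply: ae_ge0_le_integral => //.
- by move=> x _; apply: adde_ge0; [rewrite lee_fin sqr_ge0|rewrite mule_ge0// lee_fin].
- apply: emeasurable_funD; first exact: mcost.
  by apply: emeasurable_funM => //; exact: mind.
- by move=> x _; apply: adde_ge0; [rewrite lee_fin sqr_ge0|rewrite mule_ge0// lee_fin].
- apply: emeasurable_funD; first exact: mcost.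
  by apply: emeasurable_funM => //; exact: mind.
have ind1 (T : Rd -> Rd) x : T x = unit_vec -> \1_(T @^-1` [set @unit_vec R n]) x = 1%R :> R.
  by move=> Tx; rewrite indicE mem_set.
have ind0 (T : Rd -> Rd) x : T x = 0%R -> \1_(T @^-1` [set @unit_vec R n]) x = 0%R :> R.
  move=> Tx; rewrite indicE memNset//= Tx => e0.
  by have := @unit_vec_neq0 R n; rewrite -e0 eqxx.
apply: filterS (transport_halfspace_ae trS) => x Sx _.
rewrite -!EFinM -!EFinD lee_fin.
(* Choosing [unit_vec] rather than 0 changes the priced cost by 2 (t - x_0), whose sign is the test
   made by [halfspace_map]. *)
have [tx|xt] := ltP t (x 0%R ord0).
  have Tx : halfspace_map t x = unit_vec by rewrite /halfspace_map tx.
  rewrite (ind1 _ _ Tx) Tx; case: Sx => Sx.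
    by rewrite (ind0 _ _ Sx) Sx enorm_sub_unit_vec subr0; lra.
  by rewrite (ind1 _ _ Sx) Sx.
have Tx : halfspace_map t x = 0%R by rewrite /halfspace_map ltNge xt.
rewrite (ind0 _ _ Tx) Tx; case: Sx => Sx.
  by rewrite (ind0 _ _ Sx) Sx.
by rewrite (ind1 _ _ Sx) Sx enorm_sub_unit_vec subr0; lra.
Qed.

Definition ramp (t : R) (x : Rd) : R := Num.max 0%R (x 0%R ord0 - t)%R.

Lemma continuous_ramp t : continuous (ramp t).
Proof.
move=> x; apply: (@continuous_max R Rd (fun=> 0%R) (fun x : Rd => x 0%R ord0 - t)%R).
  exact: cst_continuous.
apply: (@continuousB _ R^o Rd (fun x : Rd => x 0%R ord0) (cst t)).
  exact: coord_continuous.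
exact: cst_continuous.
Qed.

Lemma measurable_ramp t : measurable_fun setT (ramp t).
Proof.
apply: measurable_maxr; first exact: measurable_cst.
by apply: measurable_funB; [exact: measurable_coord|exact: measurable_cst].
Qed.

Lemma ramp_ge0 t x : (0 <= ramp t x)%R.
Proof. by rewrite /ramp le_max lexx. Qed.

Lemma ramp_sqr_le t x : (0 <= t)%R -> (ramp t x ^+ 2 <= x 0 ord0 ^+ 2)%R.
Proof.
move=> t0; rewrite /ramp; case: (leP 0%R (x 0%R ord0 - t)%R) => xt.
  by rewrite ler_pXn2r// ?nnegrE; lra.
by rewrite expr0n sqr_ge0.
Qed.

Lemma integrable_coord_sqr :
  rho.-integrable setT (fun x : Rd => (x 0 ord0 ^+ 2)%R%:E).
Proof.
have msq : measurable_fun setT (fun x : Rd => (x 0 ord0 ^+ 2)%R%:E : \bar R).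
  by apply/measurable_EFinP; apply: measurable_funX; exact: measurable_coord.
apply/integrableP; split => //.
under eq_integral do rewrite gee0_abs ?lee_fin ?sqr_ge0//.
exact: std_gaussian_coord_sqr_lty.
Qed.

(** From (r - 1)^2 >= 0 one gets r <= 1 + r^2, which reduces integrability to the second moment of
    x_0. *)
Lemma integrable_ramp t : (0 <= t)%R -> rho.-integrable setT (EFin \o ramp t).
Proof.
move=> t0; have intc : rho.-integrable setT (cst (1%R%:E : \bar R)).
  by apply: finite_measure_integrable_cst.
apply: (le_integrable measurableT _ _ (integrableD measurableT intc integrable_coord_sqr)).
  by apply/measurable_EFinP; exact: measurable_ramp.
move=> x _; change (`|(ramp t x)%:E| <= `|(1 + x 0 ord0 ^+ 2)%R%:E|).
rewrite lee_fin ger0_norm ?ramp_ge0// ger0_norm ?addr_ge0 ?sqr_ge0//.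
have := ramp_sqr_le x t0; have := ramp_ge0 t x.
by move: (ramp t x) => r r0; have := sqr_ge0 (r - 1); rewrite sqrrB1; lra.
Qed.

Definition halfspace_potential (t : R) (x : Rd) : \bar R :=
  (ramp t x - fine (\int[rho]_y (ramp t y)%:E))%R%:E.

(** The ramp is continuous, convex as a maximum of affine functions, and square integrable by the
    second moment of x_0; subtracting its mean centres it. *)
Lemma brenier_potential_halfspace t : (1 <= t)%R ->
  brenier_potential rho (halfspace_law t) (halfspace_potential t).
Proof.
move=> t1; have t0 : (0 <= t)%R by exact: le_trans t1.
set M : R := fine (\int[rho]_y (ramp t y)%:E).
have intr := integrable_ramp t0.
split.
- apply/lower_semicontinuousP => a.
  have -> : [set x | a%:E < halfspace_potential t x] = ramp t @^-1` `](a + M)%R, +oo[%classic.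
    by apply/seteqP; split => x; rewrite /halfspace_potential/= in_itv/= andbT lte_fin ltrBrDr.
  by apply: open_comp; [move=> x _; exact: continuous_ramp|exact: interval_open].
- split => [x|x y s /andP[s0 s1]]; first by [].
  rewrite /halfspace_potential -!EFinM -EFinD lee_fin -/M.
  suff : (ramp t (s *: x + (1 - s) *: y) <= s * ramp t x + (1 - s) * ramp t y)%R by lra.
  have /ltW s'0 : (0 < 1 - s)%R by rewrite subr_gt0.
  rewrite {1}/ramp ge_max addr_ge0 ?mulr_ge0 ?ramp_ge0 ?(ltW s0)//= !mxE.
  have rx (z : Rd) : (z 0 ord0 - t <= ramp t z)%R by rewrite /ramp le_max lexx orbT.
  have := ler_wpM2l (ltW s0) (rx x); have := ler_wpM2l s'0 (rx y).
  by lra.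
- rewrite unlock; apply: poweR_lty.
  (* The dominating function comes from (r - M)^2 <= 2 r^2 + 2 M^2 with r^2 <= x_0^2. *)
  have int2 := integrableD measurableT (integrableZl measurableT 2 integrable_coord_sqr)
    (finite_measure_integrable_cst rho (2 * M ^+ 2)%R measurableT).
  have /integrableP[mint2 lty2] := int2.
  apply: le_lt_trans lty2; apply: ge0_le_integral => //.
  + by move=> x _; exact: poweR_ge0.
  + apply: (@measurableT_comp _ _ _ _ _ _ (fun y : \bar R => y `^ 2)).
      exact: measurable_poweR.
    apply: measurableT_comp => //; apply/measurable_EFinP.
    by apply: measurable_funB; [exact: measurable_ramp|exact: measurable_cst].
  + exact: measurableT_comp.
  + move=> x _; rewrite /halfspace_potential abse_EFin poweR_EFin (powR_mulrn 2)// -/M.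
    rewrite -normrX ger0_norm ?sqr_ge0//.
    change (((ramp t x - M) ^+ 2)%R%:E <= `|(2 * x 0 ord0 ^+ 2 + 2 * M ^+ 2)%R%:E|).
    rewrite lee_fin ger0_norm; last by rewrite addr_ge0// mulr_ge0// sqr_ge0.
    have := ramp_sqr_le x t0; move: (ramp t x) => r.
    by have := sqr_ge0 (r + M); rewrite sqrrD sqrrB; lra.
- transitivity (\int[rho]_x ((ramp t x)%:E - (cst M%:E x))).
    by apply: eq_integral => x _; rewrite /halfspace_potential EFinB.
  rewrite integralB//; last exact: finite_measure_integrable_cst.
  rewrite integral_cst//= probability_setT mule1 /M fineK ?subee//.
    exact: integrable_fin_num intr.
  exact: integrable_fin_num intr.
- exists (halfspace_map t); first exact: brenier_map_halfspace.
  (* The kink of the ramp is the hyperplane x_0 = t, written with a degenerate interval to apply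
     [std_gaussian_coord]. Off it the ramp is locally affine. *)
  have wall : rho.-negligible [set x : Rd | x 0%R ord0 \in `[t, t]].
    apply/negligibleP.
      rewrite -[X in measurable X]setTI.
      exact: (@measurable_coord R _ ord0 measurableT _ (measurable_itv `[t, t])).
    apply: eq_trans (std_gaussian_coord (measurable_itv `[t, t])) _.
    have /null_content_dominatesP := @normal_prob_dominates R 0 1; apply => //.
    by apply: eq_trans (lebesgue_measure_itv _) _; rewrite /= ltxx.
  apply: negligibleS wall => x /= ngrad; rewrite in_itv/= -eq_le.
  apply/negPn/negP => xt; apply: ngrad.
  apply: near_affine_has_gradient; have [tx|xt'|tx] := ltgtP t (x 0%R ord0).
  + have -> : halfspace_map t x = unit_vec by rewrite /halfspace_map tx.
    have : \forall y \near (x : Rd), (t < (y : Rd) 0%R ord0)%R.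
      exact: (@coord_continuous _ _ _ 0%R ord0 x _ (lt_nbhsr tx)).
    apply: filterS => y ty; rewrite dotp_delta !mxE /ramp.
    by rewrite !max_r ?subr_ge0 ?ltW//; lra.
  + have -> : halfspace_map t x = 0%R by rewrite /halfspace_map ltNge (ltW xt').
    have : \forall y \near (x : Rd), ((y : Rd) 0%R ord0 < t)%R.
      exact: (@coord_continuous _ _ _ 0%R ord0 x _ (lt_nbhsl xt')).
    apply: filterS => y ty; rewrite dotp0l /ramp.
    by rewrite !max_l ?subr_le0 ?ltW//; lra.
  + by rewrite tx eqxx in xt.
Qed.

Lemma brenier_potential_dirac0 :
  brenier_potential rho \d_(0%R : Rd) (fun=> 0).
Proof.
split.
- apply/lower_semicontinuousP => a; have [a0|a0] := ltP a%:E 0.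
    by rewrite (_ : [set _ | _] = setT); [exact: openT|exact/seteqP].
  rewrite (_ : [set _ | _] = set0); first exact: open0.
  by apply/seteqP; split => x //=; rewrite ltNge a0.
- by split => // x y s _; rewrite !mule0 adde0.
- by rewrite Lnorm0// ltry.
- by rewrite integral0.
exists (fun=> 0%R).
  split; first split => [|A mA]; first exact: measurable_cst.
    rewrite /pushforward /= diracE; have [A0|A0] := boolP (0%R \in A).
      by rewrite (_ : _ @^-1` _ = setT) ?probability_setT//;
        apply/seteqP; split => x //= _; exact: set_mem.
    by rewrite (_ : _ @^-1` _ = set0) ?measure0//;
      apply/seteqP; split => x //= /mem_set; exact/negP.
  (* Every competitor vanishes almost everywhere, so all costs are equal. *)
  move=> S [mS lawS]; rewrite le_eqVlt; apply/orP; left; apply/eqP.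
  have m0 := measurable_set1_rV (0%R : Rd).
  apply: ge0_ae_eq_integral => //.
  - by apply: measurable_transport_cost; exact: measurable_cst.
  - exact: measurable_transport_cost.
  - by move=> x _; rewrite lee_fin sqr_ge0.
  - by move=> x _; rewrite lee_fin sqr_ge0.
  exists (S @^-1` ~` [set 0%R]); split => //.
  - by rewrite -[X in measurable X]setTI; apply: mS => //; exact: measurableC.
  - by rewrite [LHS](lawS _ (measurableC m0)) /= diracE memNset//; apply.
  - by move=> x /= nE Sx; apply: nE => _; rewrite Sx.
apply: aeW => x; apply: near_affine_has_gradient.
by near=> y; rewrite dotp0l addr0.
Unshelve. all: by end_near. Qed.

End halfspace_potential.

(** * From the gap in [t] to the rate in W1, and the sharpness theorem *)

(** Since |ln w| >= t^2/2, the factor |ln w|^-2 is at most 4 t^-4. The square of the 1/2 cancels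
    this 4, and t^-4 <= t^-3, so the logarithmic exponent 1 is enough to pay for t^-3. *)
Lemma gap_rate_le (R : realType) (t w : R) : (1 <= t)%R -> (0 < w)%R ->
  (w <= expR (- t ^+ 2 / 2))%R ->
  ((Num.sqrt (@gap_cst R) / 2 * w `^ 2^-1 * `|ln w| `^ (- 1)) ^+ 2 <=
   gap_cst * expR (- t ^+ 2 / 2) / t ^+ 3)%R.
Proof.
move=> t1 w0 we; have t0 : (0 < t)%R by rewrite (lt_le_trans _ t1).
have t2 : (0 < t ^+ 2)%R by rewrite exprn_gt0.
have := @gap_cst_gt0 R; move: gap_cst => g g0.
have lnw : (t ^+ 2 / 2 <= - ln w)%R.
  rewrite lerNr -mulNr; by rewrite -[leRHS]expRK ler_ln ?posrE ?expR_gt0.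
have lw0 : (0 < - ln w)%R by lra.
rewrite ltr0_norm ?powR_inv1 ?(ltW lw0)//; last by lra.
rewrite !exprMn sqr_sqrtr ?(ltW g0)// powR12_sqrt ?(ltW w0)// sqr_sqrtr ?(ltW w0)//.
move: lw0 lnw; set l := (- ln w)%R => lw0 lnw.
have -> : (g * 2^-1 ^+ 2 * w * l^-1 ^+ 2 = g * (w * (2^-1 ^+ 2 * l^-1 ^+ 2)))%R by ring.
rewrite -[leRHS]mulrA ler_wpM2l ?(ltW g0)// ler_pM ?(ltW w0)//.
  by rewrite mulr_ge0 ?sqr_ge0.
have inv_le : (l^-1 <= 2 / t ^+ 2)%R.
  by rewrite -[(2 / _)%R]invf_div lef_pV2 ?posrE ?divr_gt0//; lra.
apply: (@le_trans _ _ ((2^-1 ^+ 2) * (2 / t ^+ 2) ^+ 2)%R).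
  by rewrite ler_wpM2l ?sqr_ge0// ler_pXn2r ?nnegrE ?invr_ge0 ?divr_ge0 ?(ltW lw0) ?(ltW t2).
have -> : (2^-1 ^+ 2 * (2 / t ^+ 2) ^+ 2 = t ^- 4 :> R)%R by field; rewrite gt_eqF.
by rewrite lef_pV2 ?posrE ?exprn_gt0// ler_weXn2l.
Qed.

(** In dimension 0 all probability measures coincide, whence [d_gt0]. The existence clause keeps the
    final bound, stated for all potentials, from being vacuous. *)
Theorem proposition6p10 (R : realType) (d : nat) (d_gt0 : (0 < d)%N) :
  exists (Y : set 'rV[R]_d) (c a : R) (mu nu : nat -> probability 'rV[R]_d R),
    [/\ compact Y, (0 < c)%R, (0 <= a)%R,
        forall k, mu k Y = 1 /\ nu k Y = 1 &
        [/\ forall k, 0 < W1 (mu k) (nu k),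
            W1 (mu k) (nu k) @[k --> \oo] --> 0,
            forall k,
              (exists phi, brenier_potential (@std_gaussian R d) (mu k) phi) /\
              (exists psi, brenier_potential (@std_gaussian R d) (nu k) psi) &
            \forall k \near \oo, forall phi psi,
              brenier_potential (@std_gaussian R d) (mu k) phi ->
              brenier_potential (@std_gaussian R d) (nu k) psi ->
              let w := fine (W1 (mu k) (nu k)) in
              (c * w `^ 2^-1 * `|ln w| `^ (- a))%:E <=
              'N[@std_gaussian R d]_2%:E[(fun x => phi x - psi x)]]].
Proof.
case: d d_gt0 => // n _.
(* The thresholds are t = k + 1, so t >= 1 holds already at k = 0 and the bound will hold for every
   k. *)
have t1 k : (1 <= k.+1%:R :> R)%R by rewrite ler1n.
have t0 k : (0 <= k.+1%:R :> R)%R by [].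
have W1_le k : W1 (halfspace_law k.+1%:R) \d_(0%R : 'rV[R]_n.+1) <=
    (expR (- k.+1%:R ^+ 2 / 2))%:E.
  by rewrite W1_halfspace measure_halfspace; exact: normal_prob_tail.
exists [set 0%R; unit_vec], (Num.sqrt (@gap_cst R) / 2)%R, 1%R.
exists (fun k => halfspace_law k.+1%:R), (fun=> \d_(0%R : 'rV[R]_n.+1)).
split => //.
- by apply: compactU; exact: compact_set1.
- by rewrite divr_gt0// sqrtr_gt0 gap_cst_gt0.
- move=> k; split; last by rewrite /= diracE mem_set//; left.
  by rewrite halfspace_lawE halfspace_map_preimage01 probability_setT.
split.
- by move=> k; rewrite W1_halfspace halfspace_gt0.
(* The harmonic bound follows from exp(t^2/2) >= 1 + t^2/2 >= t. *)
- apply: (@squeeze_cvge _ _ _ _ (cst 0) _ (fun k => (k.+1%:R^-1)%R%:E)).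
  + apply: nearW => k; rewrite W1_halfspace measure_ge0/= -W1_halfspace.
    rewrite (le_trans (W1_le k))// lee_fin mulNr expRN.
    rewrite lef_pV2 ?posrE ?expR_gt0 ?ltr0Sn//.
    apply: le_trans (expR_ge1Dx _).
    by have := sqr_ge0 (k.+1%:R - 1 : R)%R; rewrite sqrrB1; lra.
  + exact: cvg_cst.
  + by apply: cvg_EFin; [exact: nearW|exact: cvg_harmonic].
- move=> k; split; first by exists (halfspace_potential k.+1%:R);
    exact: brenier_potential_halfspace.
  by exists (fun=> 0); exact: brenier_potential_dirac0.
apply: nearW => k phi psi potphi potpsi /=; set w := fine _.
have [m phiE] := potential_halfspace (lt_le_trans ltr01 (t1 k)) potphi.
have [b psiE] := potential_dirac0 potpsi.
have mphi : measurable_fun setT phi.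
  by case: potphi => + _ _ _ _; exact: lower_semicontinuous_measurable_rV.
have mpsi : measurable_fun setT psi.
  by case: potpsi => + _ _ _ _; exact: lower_semicontinuous_measurable_rV.
have gap := potential_gap (t1 k) mphi mpsi phiE psiE.
have Ew : w%:E = @std_gaussian R n.+1 (halfspace k.+1%:R).
  rewrite /w W1_halfspace fineK// fin_num_measure//.
  exact: measurable_halfspace.
have w0 : (0 < w)%R by rewrite -lte_fin Ew halfspace_gt0.
have we : (w <= expR (- k.+1%:R ^+ 2 / 2))%R.
  by rewrite -lee_fin Ew measure_halfspace normal_prob_tail.
set z : R := (_ * _ * _)%R.
have z0 : (0 <= z)%R by rewrite !mulr_ge0 ?powR_ge0 ?invr_ge0 ?sqrtr_ge0.
rewrite unlock.
(* Writing both sides as square roots reduces the claim to the squared estimates [gap] and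
   [gap_rate_le]. *)
have -> : z%:E = (z ^+ 2)%R%:E `^ 2^-1.
  by rewrite poweR_EFin powR12_sqrt ?sqr_ge0// sqrtr_sqr ger0_norm.
apply: gt0_ler_poweR; rewrite ?in_itv/= ?leey ?andbT ?lee_fin ?sqr_ge0//.
  by apply: integral_ge0 => x _; exact: poweR_ge0.
by apply: le_trans gap; rewrite lee_fin gap_rate_le.
Qed.
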